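(* Let $m,n\in\mathbb{N}_0$ and let $f\in L^2(\mathbb{R}^2;\mathbb{H})$ (also integrable over $\mathbb{R}^2$). Then the quaternion Fourier transform of the function $\mathbf{x}\mapsto i^m f(\mathbf{x})\,j^n$ is given by $$\widehat{i^m f\, j^n}(\mathbf{u})=i^m\,\hat f(\mathbf{u})\,j^n,\qquad \mathbf{u}\in\mathbb{R}^2 .$$
   Context: $\mathbb{H}$ is the real quaternion algebra with units $i,j,k$, $ij=-ji=k$, $jk=-kj=i$, $ki=-ik=j$, $i^2=j^2=k^2=ijk=-1$, with $|q|=\sqrt{q_r^2+q_i^2+q_j^2+q_k^2}$ for $q=q_r+q_i i+q_j j+q_k k$. $L^2(\mathbb{R}^2;\mathbb{H})$ is the set of functions $f:\mathbb{R}^2\to\mathbb{H}$ with $\int_{\mathbb{R}^2}|f(\mathbf{x})|^2\,d^2\mathbf{x}<\infty$. For $\mathbf{x}=(x,y)$ and $\mathbf{u}=(u,v)$ in $\mathbb{R}^2$, the quaternion Fourier transform (QFT) of $f$ is $$\hat f(\mathbf{u})=\int_{\mathbb{R}^2}e^{-i xu}\,f(\mathbf{x})\,e^{-j yv}\,d^2\mathbf{x},\qquad d^2\mathbf{x}=dx\,dy.$$ *)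

(* Defs.v *)
From HB Require Import structures.
From mathcomp Require Import all_boot all_order all_algebra.
From mathcomp Require Import all_classical all_reals all_analysis.
From mathcomp Require Import ring.

Set Implicit Arguments.
Unset Strict Implicit.
Unset Printing Implicit Defensive.

Import Order.TTheory GRing.Theory Num.Theory.
Import numFieldNormedType.Exports.

Local Open Scope classical_set_scope.
Local Open Scope ring_scope.

Record quat (R : Type) := Quat { q_r : R; q_i : R; q_j : R; q_k : R }.

Section QuatCombinatorics.
Variable R : Type.

Definition quat_tuple (q : quat R) := (q_r q, q_i q, q_j q, q_k q).

Definition tuple_quat (t : R * R * R * R) :=
  let: (a, b, c, d) := t in Quat a b c d.

Lemma quat_tupleK : cancel quat_tuple tuple_quat.
Proof. by case. Qed.

End QuatCombinatorics.

HB.instance Definition _ (R : eqType) :=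
  Equality.copy (quat R) (can_type (@quat_tupleK R)).
HB.instance Definition _ (R : choiceType) :=
  Choice.copy (quat R) (can_type (@quat_tupleK R)).

Section QuatAlgebra.
Variable R : comNzRingType.
Implicit Types p q : quat R.

Definition quat0 : quat R := Quat 0 0 0 0.
Definition quat1 : quat R := Quat 1 0 0 0.

Definition oppq q := Quat (- q_r q) (- q_i q) (- q_j q) (- q_k q).

Definition addq p q :=
  Quat (q_r p + q_r q) (q_i p + q_i q) (q_j p + q_j q) (q_k p + q_k q).

Definition scaleq (a : R) q := Quat (a * q_r q) (a * q_i q) (a * q_j q) (a * q_k q).

Definition mulq p q := Quat
  (q_r p * q_r q - q_i p * q_i q - q_j p * q_j q - q_k p * q_k q)
  (q_r p * q_i q + q_i p * q_r q + q_j p * q_k q - q_k p * q_j q)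
  (q_r p * q_j q - q_i p * q_k q + q_j p * q_r q + q_k p * q_i q)
  (q_r p * q_k q + q_i p * q_j q - q_j p * q_i q + q_k p * q_r q).

Lemma addqA : associative addq.
Proof. by move=> [? ? ? ?] [? ? ? ?] [? ? ? ?]; congr Quat => /=; ring. Qed.

Lemma addqC : commutative addq.
Proof. by move=> [? ? ? ?] [? ? ? ?]; congr Quat => /=; ring. Qed.

Lemma add0q : left_id quat0 addq.
Proof. by move=> [? ? ? ?]; congr Quat => /=; ring. Qed.

Lemma addNq : left_inverse quat0 oppq addq.
Proof. by move=> [? ? ? ?]; congr Quat => /=; ring. Qed.

HB.instance Definition _ :=
  GRing.isZmodule.Build (quat R) addqA addqC add0q addNq.

Lemma mulqA : associative mulq.
Proof. by move=> [? ? ? ?] [? ? ? ?] [? ? ? ?]; congr Quat => /=; ring. Qed.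

Lemma mul1q : left_id quat1 mulq.
Proof. by move=> [? ? ? ?]; congr Quat => /=; ring. Qed.

Lemma mulq1 : right_id quat1 mulq.
Proof. by move=> [? ? ? ?]; congr Quat => /=; ring. Qed.

Lemma mulqDl : left_distributive mulq +%R.
Proof. by move=> [? ? ? ?] [? ? ? ?] [? ? ? ?]; congr Quat => /=; ring. Qed.

Lemma mulqDr : right_distributive mulq +%R.
Proof. by move=> [? ? ? ?] [? ? ? ?] [? ? ? ?]; congr Quat => /=; ring. Qed.

Lemma quat1_neq0 : quat1 != 0.
Proof. by apply/eqP => -[] /eqP; rewrite oner_eq0. Qed.

HB.instance Definition _ :=
  GRing.Zmodule_isNzRing.Build (quat R) mulqA mul1q mulq1 mulqDl mulqDr quat1_neq0.

Lemma scaleqA a b q : scaleq a (scaleq b q) = scaleq (a * b) q.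
Proof. by case: q => ? ? ? ?; congr Quat => /=; ring. Qed.

Lemma scale1q : left_id 1 scaleq.
Proof. by move=> [? ? ? ?]; congr Quat => /=; ring. Qed.

Lemma scaleqDr : right_distributive scaleq +%R.
Proof. by move=> ? [? ? ? ?] [? ? ? ?]; congr Quat => /=; ring. Qed.

Lemma scaleqDl q : {morph scaleq^~ q : a b / a + b}.
Proof. by case: q => ? ? ? ? ? ?; congr Quat => /=; ring. Qed.

HB.instance Definition _ :=
  GRing.Zmodule_isLmodule.Build R (quat R) scaleqA scale1q scaleqDr scaleqDl.

Lemma scaleqAl (a : R) p q : a *: (p * q) = (a *: p) * q.
Proof. by case: p q => ? ? ? ? [? ? ? ?]; congr Quat => /=; ring. Qed.

HB.instance Definition _ := GRing.Lmodule_isLalgebra.Build R (quat R) scaleqAl.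

Lemma scaleqAr (a : R) p q : a *: (p * q) = p * (a *: q).
Proof. by case: p q => ? ? ? ? [? ? ? ?]; congr Quat => /=; ring. Qed.

HB.instance Definition _ := GRing.Lalgebra_isAlgebra.Build R (quat R) scaleqAr.

Definition iH : quat R := Quat 0 1 0 0.
Definition jH : quat R := Quat 0 0 1 0.
Definition kH : quat R := Quat 0 0 0 1.

Lemma quat_relations :
  [/\ iH * jH = kH /\ jH * iH = - kH,
      jH * kH = iH /\ kH * jH = - iH,
      kH * iH = jH /\ iH * kH = - jH &
      [/\ iH ^+ 2 = -1, jH ^+ 2 = -1, kH ^+ 2 = -1 & iH * jH * kH = -1]].
Proof. by split; split; rewrite ?expr2; congr Quat => /=; ring. Qed.

Lemma quatE q :
  q = (q_r q)%:A + q_i q *: iH + q_j q *: jH + q_k q *: kH.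
Proof. by case: q => ? ? ? ?; congr Quat => /=; ring. Qed.

End QuatAlgebra.

Arguments iH {R}.
Arguments jH {R}.
Arguments kH {R}.

Section QuatAnalysis.
Variable R : realType.
Implicit Types (q : quat R) (f g : R * R -> quat R).

Definition normq q : R :=
  Num.sqrt (q_r q ^+ 2 + q_i q ^+ 2 + q_j q ^+ 2 + q_k q ^+ 2).

Definition expq_psum q (n : nat) : quat R :=
  \sum_(0 <= l < n) (l`!%:R)^-1 *: q ^+ l.

(* exp q = sum_l q^l / l!, the limit being taken in each real component *)
Definition expq q : quat R := Quat
  (limn (fun n => q_r (expq_psum q n))) (limn (fun n => q_i (expq_psum q n)))
  (limn (fun n => q_j (expq_psum q n))) (limn (fun n => q_k (expq_psum q n))).

Definition plane_measure := (@lebesgue_measure R \x @lebesgue_measure R)%E.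

Definition Borel_quat g :=
  [/\ measurable_fun setT (fun x => q_r (g x)),
      measurable_fun setT (fun x => q_i (g x)),
      measurable_fun setT (fun x => q_j (g x)) &
      measurable_fun setT (fun x => q_k (g x))].

(* The sigma-algebra of R * R is the Borel one, so Lebesgue measurability is
   expressed as almost everywhere equality with a Borel function. *)
Definition Lebesgue_quat f :=
  exists2 g, Borel_quat g & {ae plane_measure, forall x, f x = g x}.

Definition L1_quat f :=
  Lebesgue_quat f /\ (\int[plane_measure]_x (normq (f x))%:E < +oo)%E.

Definition L2_quat f :=
  Lebesgue_quat f /\ (\int[plane_measure]_x (normq (f x) ^+ 2)%:E < +oo)%E.

Definition integralq f : quat R := Quat
  (\int[plane_measure]_x q_r (f x)) (\int[plane_measure]_x q_i (f x))
  (\int[plane_measure]_x q_j (f x)) (\int[plane_measure]_x q_k (f x)).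

Definition QFT f (u : R * R) : quat R :=
  integralq (fun x =>
    expq (- (x.1 * u.1) *: iH) * f x * expq (- (x.2 * u.2) *: jH)).

End QuatAnalysis.

Section Euler.
Variable R : realType.
Implicit Types (mu : quat R) (t : R).

Lemma expq_psumE mu t n : mu ^+ 2 = -1 ->
  expq_psum (t *: mu) n =
  (series (cos_coeff t) n)%:A + (series (sin_coeff t) n) *: mu.
Proof.
move=> mu2; rewrite /expq_psum /series /= !scaler_suml -big_split /=.
apply: eq_bigr => l _; rewrite exprZn scalerA.
have mu2X k : mu ^+ (k.*2) = (-1) ^+ k *: 1.
  by rewrite -mul2n exprM mu2 -[-1 in LHS]scaleN1r exprZn expr1n.
rewrite /cos_coeff /sin_coeff /= -(odd_double_half l).
move: (odd l) l./2 => b k; rewrite !oddD !odd_double !addbF.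
case: b; rewrite /= ?add1n ?add0n ?uphalf_double ?doubleK ?[mu ^+ _.+1]exprS mu2X.
- rewrite -scalerAr mulr1 scalerA !mul0r scale0r add0r.
  by congr (_ *: _); rewrite mul1r -[LHS]mulrA [LHS]mulrC [X in X * _]mulrC.
- rewrite scalerA !mul0r scale0r addr0 -exprnP.
  by congr (_ *: _); rewrite mul1r -[LHS]mulrA [LHS]mulrC [X in X * _]mulrC.
Qed.

Lemma expq_Euler mu t : mu ^+ 2 = -1 ->
  expq (t *: mu) = (cos t)%:A + sin t *: mu.
Proof.
move=> mu2; have cc : series (cos_coeff t) @ \oo --> cos t.
  by rewrite cos.unlock; exact: is_cvg_series_cos_coeff.
have cs : series (sin_coeff t) @ \oo --> sin t.
  by rewrite sin.unlock; exact: is_cvg_series_sin_coeff.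
by congr Quat; under eq_fun do rewrite expq_psumE //=;
  apply/cvg_lim => //; apply: cvgD; apply: cvgMl.
Qed.

Lemma expq_iH t : expq (t *: iH) = Quat (cos t) (sin t) 0 0.
Proof.
rewrite expq_Euler; last by case: (quat_relations R) => _ _ _ [].
by congr Quat => /=; ring.
Qed.

Lemma expq_jH t : expq (t *: jH) = Quat (cos t) 0 (sin t) 0.
Proof.
rewrite expq_Euler; last by case: (quat_relations R) => _ _ _ [].
by congr Quat => /=; ring.
Qed.

End Euler.

(* Main.v *)
(** Left multiplication by [i] commutes with [exp (- x u i)] and right
    multiplication by [j] with [exp (- y v j)], so both leave the integrand;
    on components they only permute coordinates up to sign, hence they also
    leave the integral, which is odd in its integrand. *)
Require Import Defs.
From mathcomp Require Import all_boot all_order all_algebra.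
From mathcomp Require Import all_classical all_reals all_analysis.
From mathcomp Require Import ring.

Import GRing.Theory.
Local Open Scope ring_scope.

(* Negation swaps the positive and negative parts; if both have infinite
   integral then both sides are [fine] of an infinity, that is [0]. *)
Lemma RintegralN_total d (T : measurableType d) (R : realType)
    (mu : {measure set T -> \bar R}) (D : set T) (f : T -> R) :
  \int[mu]_(x in D) (- f x) = - \int[mu]_(x in D) f x.
Proof.
rewrite /Rintegral integralE [in RHS]integralE.
have -> : (fun x => (- f x)%:E) = (\- (EFin \o f))%E by [].
rewrite funeposN funenegN.
by case: (\int[mu]_(x in D) _)%E => [a||]; case: (\int[mu]_(x in D) _)%E => [b||];
  rewrite /= ?oppr0 ?opprB.
Qed.

Lemma mul_iH (R : comNzRingType) (q : quat R) :
  iH * q = Quat (- q_i q) (q_r q) (- q_k q) (q_j q).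
Proof. by case: q => *; congr Quat => /=; ring. Qed.

Lemma mul_jH (R : comNzRingType) (q : quat R) :
  q * jH = Quat (- q_j q) (- q_k q) (q_r q) (q_i q).
Proof. by case: q => *; congr Quat => /=; ring. Qed.

Section IntegralQFT.
Variable R : realType.
Implicit Types (f g : R * R -> quat R) (u : R * R) (t : R).

Lemma integralq_iHl g : integralq (fun x => iH * g x) = iH * integralq g.
Proof.
under eq_fun do rewrite mul_iH.
(* The coordinates without a sign agree by computation; the two negated ones use oddness of the
   integral. *)
by rewrite mul_iH; congr Quat; exact: RintegralN_total.
Qed.

Lemma integralq_jHr g : integralq (fun x => g x * jH) = integralq g * jH.
Proof.
under eq_fun do rewrite mul_jH.
by rewrite mul_jH; congr Quat; exact: RintegralN_total.
Qed.

(** By Euler's formula the exponential lies in the real span of [1] and [iH], a commutative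
    subalgebra. *)
Lemma expq_iHC t : GRing.comm (expq (t *: iH)) iH.
Proof. by rewrite /GRing.comm expq_iH; congr Quat => /=; ring. Qed.

Lemma expq_jHC t : GRing.comm (expq (t *: jH)) jH.
Proof. by rewrite /GRing.comm expq_jH; congr Quat => /=; ring. Qed.

Lemma QFT_iHl f u : QFT (fun x => iH * f x) u = iH * QFT f u.
Proof.
rewrite /QFT -integralq_iHl; congr integralq; apply/funext => x.
by rewrite !mulrA expq_iHC.
Qed.

Lemma QFT_jHr f u : QFT (fun x => f x * jH) u = QFT f u * jH.
Proof.
rewrite /QFT -integralq_jHr; congr integralq; apply/funext => x.
(* Regrouping the right-hand side puts the kernel next to the outer [jH], so that the two can be
   swapped. *)
by rewrite -[RHS]mulrA [X in _ = _ * X]expq_jHC !mulrA.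
Qed.

Lemma QFT_iHXl f u m : QFT (fun x => iH ^+ m * f x) u = iH ^+ m * QFT f u.
Proof.
elim: m => [|m IHm]; first by under eq_fun do rewrite mul1r; rewrite mul1r.
by under eq_fun do rewrite exprS -mulrA; rewrite QFT_iHl IHm exprS mulrA.
Qed.

Lemma QFT_jHXr f u n : QFT (fun x => f x * jH ^+ n) u = QFT f u * jH ^+ n.
Proof.
elim: n => [|n IHn]; first by under eq_fun do rewrite mulr1; rewrite mulr1.
(* [exprSr] splits off the rightmost [jH], leaving the function of the induction hypothesis. *)
by under eq_fun do rewrite exprSr mulrA; rewrite QFT_jHr IHn exprSr mulrA.
Qed.

End IntegralQFT.

Theorem theorem2p5 (R : realType) (m n : nat) (f : R * R -> quat R)
    (f_L2 : L2_quat f) (f_L1 : L1_quat f) (u : R * R) :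
  QFT (fun x => iH ^+ m * f x * jH ^+ n) u = iH ^+ m * QFT f u * jH ^+ n.
(* Products associate to the left, so the power of [jH] is outermost and comes out first. *)
Proof. by rewrite QFT_jHXr QFT_iHXl. Qed.
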